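(* Let $X$ be a finite asymmetric graph and let $v$ be a vertex of $X$ such that the class $[v]=\{w\in V(X): \langle N(w,X)\rangle\cong\langle N(v,X)\rangle\}$ has odd cardinality. If $\langle N(v,X)\rangle$ does not have an automorphism that is a product of transpositions, then $X$ is not the induced neighbourhood of a finite vertex-transitive graph, i.e. there is no finite vertex-transitive graph $Y$ with $\langle N(y,Y)\rangle\cong X$ for the vertices $y$ of $Y$.
   Context: All graphs are simple. $N(v,X)$ is the set of neighbours of $v$ in $X$ and $\langle N(v,X)\rangle$ the induced subgraph on it. A graph is asymmetric if its only automorphism is the identity. An automorphism of a graph is called a product of transpositions if, as a permutation of the vertex set, it is a product of disjoint transpositions moving every vertex (a fixed-point-free involution; for the graph with no vertices, the identity). *)

(* Defs.v *)
From HB Require Import structures.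
From mathcomp Require Import all_boot all_fingroup.

Set Implicit Arguments.
Unset Strict Implicit.
Unset Printing Implicit Defensive.

Record sgraph := SGraph {
  vertex :> finType;
  adj : rel vertex;
  adj_sym : symmetric adj;
  adj_irr : irreflexive adj
}.

Section Induced.
Variables (G : sgraph) (A : {set G}).

Definition induced_adj : rel {x : G | x \in A} :=
  fun x y => adj (val x) (val y).

Fact induced_sym : symmetric induced_adj.
Proof. by move=> x y; apply: adj_sym. Qed.

Fact induced_irr : irreflexive induced_adj.
Proof. by move=> x; apply: adj_irr. Qed.

Definition induced : sgraph := SGraph induced_sym induced_irr.
End Induced.

Definition nbrs (G : sgraph) (v : G) : {set G} := [set w | adj v w].

Definition nbhd (G : sgraph) (v : G) : sgraph := induced (nbrs v).

Definition isomorphic (G H : sgraph) : Prop :=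
  exists2 f : G -> H, bijective f & forall x y, adj (f x) (f y) = adj x y.

(* Boolean form of [isomorphic] (see [isomorphicP]), used to form finite sets. *)
Definition isomorphicb (G H : sgraph) : bool :=
  [exists f : {ffun G -> H},
    [&& injectiveb f, [forall y, exists x, f x == y]
      & [forall x, forall y, adj (f x) (f y) == adj x y]]].

Lemma isomorphicP (G H : sgraph) :
  reflect (isomorphic G H) (isomorphicb G H).
Proof.
apply: (iffP existsP) => [[f /and3P[/injectiveP injf /forallP surjf homf]]|].
  have surjf' y : exists x, f x == y by apply/existsP.
  exists f => [|x y]; last by apply/eqP; move/forallP: homf => /(_ x)/forallP.
  exists (fun y => xchoose (surjf' y)) => [x|y].
    exact/injf/eqP/(xchooseP (surjf' (f x))).
  exact/eqP/(xchooseP (surjf' y)).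
case=> f [g fK gK] homf; exists [ffun x => f x]; apply/and3P; split.
- by apply/injectiveP => x y; rewrite !ffunE => /(can_inj fK).
- by apply/forallP=> y; apply/existsP; exists (g y); rewrite ffunE gK.
- by apply/forallP=> x; apply/forallP=> y; rewrite !ffunE homf.
Qed.

Definition automorphism (G : sgraph) (s : {perm G}) : Prop :=
  forall x y, adj (s x) (s y) = adj x y.

Definition asymmetric_graph (G : sgraph) : Prop :=
  forall s : {perm G}, automorphism s -> s = 1%g.

Definition vertex_transitive (G : sgraph) : Prop :=
  forall x y : G, exists2 s : {perm G}, automorphism s & s x = y.

(* The flattened list of the pairs is duplicate-free exactly when each pair is
   a genuine transposition and the pairs are disjoint; it must also list every
   point. On an empty type this holds of the identity, with ts = [::]. *)
Definition product_of_transpositions (T : finType) (s : {perm T}) : Prop :=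
  exists ts : seq (T * T),
    let pts := flatten [seq [:: t.1; t.2] | t <- ts] in
    [/\ uniq pts, forall x, x \in pts & s = (\prod_(t <- ts) tperm t.1 t.2)%g].

Definition nbhd_class (G : sgraph) (v : G) : {set G} :=
  [set w | isomorphicb (nbhd w) (nbhd v)].

(* Main.v *)
(** In a vertex-transitive [Y] whose neighbourhoods are isomorphic to the
    asymmetric graph [X], an automorphism fixing a vertex fixes all of its
    neighbours. Fix [y]; for a neighbour [w] of [y], let [s] be an automorphism
    with [s y = w]. Then [w |-> s^-1 y] is a well-defined involution of the
    neighbourhood of [y], and [s^-1] maps N(y) ∩ N(w) onto N(s^-1 y) ∩ N(y), so
    the involution preserves the isomorphism type of N(y) ∩ N(w). As the class
    of [v] is odd, some [w] in it is a fixed point, i.e. [s] swaps [y] and [w].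
    On N(y) ∩ N(w) this [s] is an involution, because [s^2] fixes [y], and it
    has no fixed point, because it would then fix the neighbour [y] of that
    point. *)

Require Import Defs.
From mathcomp Require Import all_boot all_fingroup.

Set Implicit Arguments.
Unset Strict Implicit.

(** * Pairing off a set along a fixed-point-free involution *)

Section Pairings.
Variable T : finType.
Implicit Types (A : {set T}) (ts : seq (T * T)).

Definition pair_points ts : seq T := flatten [seq [:: t.1; t.2] | t <- ts].

Lemma size_pair_points ts : size (pair_points ts) = (size ts).*2.
Proof. by elim: ts => //= t ts; rewrite /pair_points /= => ->. Qed.

(** Strong induction on [#|A|]: split off the pair [x], [i x] and recurse on the rest [B]. A subset
    [A] is allowed because parity is later counted on a proper subset of the vertices. *)
Lemma fixfree_involution_pairing A (i : T -> T) :
    {in A, forall x, i x \in A} -> {in A, forall x, i (i x) = x} ->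
    {in A, forall x, i x != x} ->
  exists ts, [/\ uniq (pair_points ts), pair_points ts =i A
    & all (fun t => t.2 == i t.1) ts].
Proof.
have [n] := ubnP #|A|; elim: n A => // n IHn A ltAn iA iK iF.
have [->|[x xA]] := set_0Vmem A.
  by exists [::]; split => // x; rewrite inE.
have ixA := iA x xA; pose B := A :\: [set x; i x].
have BA z : z \in B -> z \in A by case/setDP.
have [||z /BA zA|z /BA zA|ts [uts tsE its]] := IHn B.
- rewrite -ltnS (leq_trans _ ltAn) // ltnS; apply: proper_card; apply/properP.
  by split; [apply: subsetDl | exists x; rewrite // !inE eqxx].
(* If [i z] were [x] or [i x], applying [i] would put [z] in the removed pair. *)
- move=> z zB; have zA := BA z zB; move: zB; rewrite !inE (iA z zA) zA !andbT.
  apply: contraNN => /orP[]/eqP zi; first by rewrite -zi iK ?eqxx ?orbT.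
  by rewrite -(iK z zA) zi iK ?eqxx.
- exact: iK.
- exact: iF.
exists ((x, i x) :: ts); split; last by rewrite /= eqxx.
  rewrite /pair_points /= -/(pair_points ts) !inE uts !tsE !inE.
  by rewrite !eqxx !orbT /= orbF andbT eq_sym iF.
move=> z; rewrite /pair_points /= -/(pair_points ts) !inE tsE !inE.
by case: eqVneq => [->|_] /=; last case: eqVneq => [->|_].
Qed.

Lemma odd_involution_fixpoint A (i : T -> T) :
    {in A, forall x, i x \in A} -> {in A, forall x, i (i x) = x} -> odd #|A| ->
  exists2 x, x \in A & i x = x.
Proof.
move=> iA iK oddA.
have [/exists_inP[x xA /eqP ix]|/exists_inPn iF] :=
  boolP [exists x in A, i x == x]; first by exists x.
have [ts [uts tsE _]] := fixfree_involution_pairing iA iK iF.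
by move: oddA; rewrite -(eq_card tsE) (card_uniqP uts) size_pair_points odd_double.
Qed.

(** By disjointness at most one factor moves [x]. Points outside the list are included for the
    induction: the tail must fix both points of the head pair. *)
Lemma prod_tperm_pairs (s : {perm T}) ts :
    involutive s -> uniq (pair_points ts) -> all (fun t => t.2 == s t.1) ts ->
  forall x, (\prod_(t <- ts) tperm t.1 t.2)%g x
    = if x \in pair_points ts then s x else x.
Proof.
move=> sK; elim: ts => [|[a b] ts IHts] /=; first by move=> _ _ x; rewrite big_nil perm1.
rewrite /pair_points /= -/(pair_points ts) !inE negb_or.
case/and3P=> /andP[ab ats] bts uts /andP[/eqP bE its] x.
rewrite big_cons permM IHts //= !inE; case: tpermP => [->|->|/eqP xa /eqP xb].
- by rewrite (negPf bts) eqxx bE.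
- by rewrite (negPf ats) eqxx orbT bE sK.
by rewrite (negPf xa) (negPf xb).
Qed.

Lemma fixfree_involution_product_of_transpositions (s : {perm T}) :
  involutive s -> (forall x, s x != x) -> product_of_transpositions s.
Proof.
move=> sK sF.
have [//|x _|x _|ts [uts tsE its]] := @fixfree_involution_pairing [set: T] s.
- exact: sK.
- exact: sF.
exists ts; split=> // [x|]; first by rewrite [_ \in _]tsE inE.
by apply/permP=> x; rewrite (prod_tperm_pairs sK uts its) tsE inE.
Qed.

End Pairings.

(** * Transport along graph isomorphisms *)

Lemma isomorphic_sym (G H : sgraph) : isomorphic G H -> isomorphic H G.
Proof.
case=> f [g fK gK] fadj; exists g; first by exists f.
by move=> x y; rewrite -fadj !gK.
Qed.

Lemma isomorphic_trans (G H K : sgraph) :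
  isomorphic G H -> isomorphic H K -> isomorphic G K.
Proof.
case=> f bf fadj [g bg gadj]; exists (g \o f); first exact: bij_comp.
by move=> x y /=; rewrite gadj fadj.
Qed.

Lemma isomorphic_asymmetric (G H : sgraph) :
  isomorphic G H -> asymmetric_graph G -> asymmetric_graph H.
Proof.
case=> f [g fK gK] fadj asymG s sadj.
have injs : injective (g \o s \o f).
  exact: inj_comp (inj_comp (can_inj gK) (@perm_inj _ s)) (can_inj fK).
have /asymG/permP s1 : automorphism (perm injs).
  by move=> x y; rewrite !permE /= -fadj !gK sadj fadj.
apply/permP=> x; rewrite perm1.
by apply: (can_inj gK); move: (s1 (g x)); rewrite permE perm1 /= gK.
Qed.

Lemma isomorphic_fixfree_involution (G H : sgraph) (i : G -> G) :
    isomorphic G H -> involutive i -> (forall x, i x != x) ->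
    (forall x y, adj (i x) (i y) = adj x y) ->
  exists2 s : {perm H}, automorphism s & product_of_transpositions s.
Proof.
case=> f [g fK gK] fadj iK iF iadj; pose j := f \o i \o g.
have jK : involutive j by move=> x; rewrite /j /= fK iK gK.
exists (perm (inv_inj jK)).
  by move=> x y; rewrite !permE /j /= fadj iadj -fadj !gK.
apply: fixfree_involution_product_of_transpositions => x.
  by rewrite !permE jK.
by rewrite permE -(inj_eq (can_inj gK)) /j /= fK iF.
Qed.

(** Taking [f] on the ambient vertices lets later proofs argue by membership instead of handling
    subtypes. *)
Lemma induced_isomorphic (G H : sgraph) (A : {set G}) (B : {set H}) (f : G -> H) :
    {in A, forall x, f x \in B} -> {in B, forall y, exists2 x, x \in A & f x = y} ->
    {in A &, injective f} -> {in A &, forall x y, adj (f x) (f y) = adj x y} ->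
  isomorphic (induced A) (induced B).
Proof.
move=> fAB fsurj finj fadj.
pose h (x : induced A) : induced B := Sub (f (val x)) (fAB _ (valP x)).
have hsurj (y : induced B) : exists x, h x == y.
  have [x xA fx] := fsurj _ (valP y).
  by exists (Sub x xA); apply/eqP/val_inj.
have hinj : injective h.
  by move=> x y /(congr1 val) /= fxy; apply/val_inj/finj => //; apply: valP.
exists h => [|x y]; last by apply: fadj; apply: valP.
exists (fun y => xchoose (hsurj y)) => [x|y]; last exact/eqP/(xchooseP (hsurj y)).
exact/hinj/eqP/(xchooseP (hsurj (h x))).
Qed.

(** * Automorphisms and common neighbourhoods *)

Lemma automorphismV (G : sgraph) (s : {perm G}) : automorphism s -> automorphism (s^-1)%g.
Proof. by move=> sadj x y; rewrite -sadj !permKV. Qed.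

Lemma automorphismM (G : sgraph) (s t : {perm G}) :
  automorphism s -> automorphism t -> automorphism (s * t)%g.
Proof. by move=> sadj tadj x y; rewrite !permM tadj sadj. Qed.

(** Stands for the neighbourhood of [y] inside [nbhd x], flattened to a single subset of [G]; this
    makes it symmetric in [x] and [y]. *)
Definition common_nbhd {G : sgraph} (x y : G) : sgraph :=
  induced (nbrs x :&: nbrs y).

Lemma common_nbhdC (G : sgraph) (x y : G) : common_nbhd x y = common_nbhd y x.
Proof. by rewrite /common_nbhd setIC. Qed.

Lemma common_nbhd_automorphism (G : sgraph) (s : {perm G}) (x y : G) :
  automorphism s -> isomorphic (common_nbhd x y) (common_nbhd (s x) (s y)).
Proof.
move=> sadj; apply: (induced_isomorphic (f := s)) => [w|w|w z _ _|w z _ _].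
- by rewrite !inE !sadj.
- move=> ws; exists ((s^-1)%g w); last by rewrite permKV.
  by move: ws; rewrite -{1}[w](permKV s) !inE !sadj.
- exact: perm_inj.
- exact: sadj.
Qed.

Lemma nbhd_in_nbhd_isomorphic (Y X : sgraph) (y : Y) (g : X -> nbhd y) (x : X) :
    bijective g -> (forall a b, adj (g a) (g b) = adj a b) ->
  isomorphic (nbhd x) (common_nbhd y (val (g x))).
Proof.
case=> f gK fK gadj.
apply: (induced_isomorphic (f := fun a => val (g a))) => [a|w|a b _ _|a b _ _].
- rewrite !inE -gadj => xa; apply/andP; split=> //.
  by have := valP (g a); rewrite inE.
- case/setIP=> yw; rewrite inE => xw; exists (f (Sub w yw)); last by rewrite fK.
  by rewrite inE -gadj fK.
- by move/val_inj/(can_inj gK).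
- exact: gadj.
Qed.

(** Moves the parity hypothesis from [X] to the neighbours of [y] in [Y], where the involution
    acts. *)
Lemma card_nbhd_class (Y X : sgraph) (y : Y) (v : X) :
    isomorphic X (nbhd y) ->
  #|nbhd_class v| = #|[set w in nbrs y | isomorphicb (common_nbhd y w) (nbhd v)]|.
Proof.
case=> g bg gadj; have [f gK fK] := bg.
have vginj : injective (fun x => val (g x)) by move=> a b /val_inj/(can_inj gK).
rewrite -(card_imset _ vginj); apply: eq_card => w; apply/imsetP/setIdP.
  case=> x; rewrite inE => /isomorphicP xv ->; split; first exact: valP.
  apply/isomorphicP; apply: isomorphic_trans xv.
  exact/isomorphic_sym/nbhd_in_nbhd_isomorphic.
case=> yw /isomorphicP wv; exists (f (Sub w yw)); last by rewrite fK.
rewrite inE; apply/isomorphicP; apply: isomorphic_trans wv.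
by have := nbhd_in_nbhd_isomorphic (f (Sub w yw)) bg gadj; rewrite fK.
Qed.

(** Fixing [y], [t] restricts to an automorphism of [nbhd y], which is trivial by asymmetry. *)
Lemma automorphism_fix_nbrs (Y : sgraph) (t : {perm Y}) (y w : Y) :
    asymmetric_graph (nbhd y) -> automorphism t -> t y = y -> adj y w ->
  t w = w.
Proof.
move=> asymy tadj ty yw.
have tN x : x \in nbrs y -> t x \in nbrs y by rewrite !inE -{2}ty tadj.
pose h (x : nbhd y) : nbhd y := Sub (t (val x)) (tN _ (valP x)).
have hinj : injective h.
  by move=> a b /(congr1 val)/= /perm_inj/val_inj.
have /asymy/permP h1 : automorphism (perm hinj).
  by move=> a b; rewrite !permE; apply: tadj.
have wN : w \in nbrs y by rewrite inE.
by have := congr1 val (h1 (Sub w wN)); rewrite permE perm1.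
Qed.

Theorem theorem2p3 (X : sgraph) (v : X)
    (asymX : asymmetric_graph X)
    (odd_class : odd #|nbhd_class v|)
    (noprod : ~ exists2 s : {perm nbhd v},
                  automorphism s & product_of_transpositions s) :
  ~ exists Y : sgraph,
      [/\ 0 < #|Y|, vertex_transitive Y & forall y : Y, isomorphic (nbhd y) X].
Proof.
case=> Y [/card_gt0P[y _] transY isoY]; apply: noprod.
(* Every neighbourhood in [Y] is a copy of [X], so this rigidity holds at all vertices, not just at
   [y]. *)
have fixN (t : {perm Y}) (x w : Y) :
    automorphism t -> t x = x -> adj x w -> t w = w.
  apply: automorphism_fix_nbrs.
  exact: isomorphic_asymmetric (isomorphic_sym (isoY x)) asymX.
have [s sadj sy] : exists2 s : Y -> {perm Y},
    forall w, automorphism (s w) & forall w, s w y = w.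
  exact: (fin_all_exists2 (transY y)).
pose i w := (s w)^-1%g y.
have adji w : adj y (i w) = adj y w by rewrite -(sadj w) permKV sy adj_sym.
move: odd_class; rewrite (card_nbhd_class v (isomorphic_sym (isoY y))).
set C := [set w in _ | _] => oddC.
have [w wC|w|w wC iw] := @odd_involution_fixpoint _ C i _ _ oddC.
(* The inverse of [s w] carries the pair [y], [w] to [i w], [y]. *)
- have [] := setIdP wC; rewrite !inE adji => -> /isomorphicP wv /=.
  apply/isomorphicP; apply: isomorphic_trans wv; apply: isomorphic_sym.
  have := common_nbhd_automorphism y w (automorphismV (sadj w)).
  have -> : (s w)^-1%g w = y by rewrite -{2}(sy w) permK.
  by rewrite (common_nbhdC _ y).
- rewrite inE => /andP[]; rewrite inE => yw _.
  (* [s (i w) \o s w] fixes [i w], hence its neighbour [y]. *)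
  have := fixN (s w * s (i w))%g (i w) y (automorphismM (sadj _) (sadj _)).
  rewrite !permM permKV sy adj_sym adji yw => /(_ erefl isT) siw.
  (* By [siw], [s (i w)] sends [w] to [y], so the preimage [i (i w)] of [y] is [w]. *)
  by rewrite {1}/i -{1}siw permK sy.
have [] := setIdP wC; rewrite inE => yw /isomorphicP wv.
have sw : s w w = y by rewrite -{2}iw permKV.
(* Swapping [y] and [w] preserves the set of their common neighbours. *)
have sN x : x \in nbrs y :&: nbrs w -> s w x \in nbrs y :&: nbrs w.
  rewrite !inE => /andP[yx wx]; rewrite -[X in adj X _ && _]sw sadj wx /=.
  by rewrite -[X in adj X _](sy w) sadj.
pose j (x : common_nbhd y w) : common_nbhd y w := Sub (s w (val x)) (sN _ (valP x)).
apply: (isomorphic_fixfree_involution (i := j) wv) => [x|x|a b].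
- apply: val_inj => /=.
  have := fixN (s w * s w)%g y (val x) (automorphismM (sadj _) (sadj _)).
  by rewrite !permM sy sw; apply=> //; have := valP x; rewrite !inE => /andP[].
- apply/eqP=> /(congr1 val)/= sx.
  (* A fixed [x] would force [s w y = y], that is [w = y], although [y] and [w] are adjacent. *)
  have := fixN (s w) (val x) y (sadj w) sx; rewrite adj_sym sy.
  have := valP x; rewrite !inE => /andP[yx _] /(_ yx) wy.
  by rewrite wy adj_irr in yw.
- exact: sadj.
Qed.
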